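(* (i) Let $\Gamma$ be an additive subgroup of $\mathbb{C}$ containing $1$, let $f,g\in\Gamma^\vee$, $\alpha\in\mathbb{C}$, and $a\in\mathbb{C}^*$ with $a\Gamma=\Gamma$. Let $\varphi_{a,f}\in\operatorname{Aut}(\mathcal{W}_\Gamma)$ be given by $\varphi_{a,f}(L_m)=af(m)L_{m/a}$, and let $\Omega_\Gamma(g,\alpha)^{a,f}$ denote $\Omega_\Gamma(g,\alpha)$ after a twist by $\varphi_{a,f}$. Then $\Omega_\Gamma(g,\alpha)^{a,f}\cong\Omega_\Gamma(g',\alpha)$, where $g'(m)=f(m)g(m/a)$. (ii) Let $\Gamma$ be a subgroup of $\mathbb{C}\times\mathbb{Z}_2$, let $f,g\in\Gamma^\vee$, $\alpha\in\mathbb{C}$, and $a\in\mathbb{C}^*$ with $a^2\Gamma=\Gamma$ and $\operatorname{Re}(a)\ge0$. Let $\varphi_{a,f}\in\operatorname{Aut}(s\mathcal{W}_\Gamma)$ be given by $\varphi_{a,f}(L_m)=a^2f(m)L_{m/a^2}$, $\varphi_{a,f}(G_r)=af(r)G_{r/a^2}$, and let $s\Omega_\Gamma(g,\alpha)^{a,f}$ denote $s\Omega_\Gamma(g,\alpha)$ after a twist by $\varphi_{a,f}$. Then $s\Omega_\Gamma(g,\alpha)^{a,f}\cong s\Omega_\Gamma(g',\alpha)$, where $g'(m)=f(m)g(m/a^2)$ for $m\in\Gamma$.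
   Context: The base field is $\mathbb{C}$. $\Gamma^\vee$ is the set of group homomorphisms $\Gamma\to\mathbb{C}^*$. The twist of a module $M$ by an automorphism $\varphi$ is the same vector space with $x$ acting as $\varphi(x)$ acts on $M$. For a subgroup $\Gamma\subset\mathbb{C}$ containing $1$: $\mathcal{W}_\Gamma$ is the Lie algebra with basis $\{L_m\}_{m\in\Gamma}$, $[L_m,L_n]=(m-n)L_{m+n}$; $\Omega_\Gamma(f,\alpha)$ is $\mathbb{C}[L_0]$ with action $L_mP(L_0)=f(m)(L_0+m\alpha)P(L_0+m)$. For a subgroup $\Gamma\subset\mathbb{C}\times\mathbb{Z}_2$: $\Gamma_0=\{x\mid(x,0)\in\Gamma\}$, $\Gamma_1=\{x\mid(x,1)\in\Gamma\}$; for $f\in\Gamma^\vee$, $m\in\Gamma_0$, $r\in\Gamma_1$ write $f(m)=f((m,0))$, $f(r)=f((r,1))$; scaling of elements of $\Gamma$ by a complex number acts on the first coordinate only (so $a^2\Gamma=\Gamma$ means $a^2\Gamma_0=\Gamma_0$ and $a^2\Gamma_1=\Gamma_1$). $s\mathcal{W}_\Gamma$ is the Lie superalgebra with even basis $\{L_m\}_{m\in\Gamma_0}$, odd basis $\{G_r\}_{r\in\Gamma_1}$, $[L_m,L_n]=(m-n)L_{m+n}$, $[L_m,G_r]=(\tfrac m2-r)G_{m+r}$, $[G_r,G_s]=2L_{r+s}$. $s\Omega_\Gamma(f,\alpha)$ is $\mathbb{C}[L_0]\oplus\xi\mathbb{C}[L_0]$ (first summand even, second odd) with $$L_m(P(L_0)+\xi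 Q(L_0))=f(m)(L_0+m\alpha)P(L_0+m)+f(m)(L_0+m(\alpha+\tfrac12))\,\xi Q(L_0+m),$$ $$G_r(P(L_0)+\xi Q(L_0))=f(r)(L_0+2r\alpha)Q(L_0+r)+f(r)\,\xi P(L_0+r),$$ where $p(L_0)\xi q(L_0)$ means $\xi p(L_0)q(L_0)$. *)

(* Defs.v *)
From HB Require Import structures.
From mathcomp Require Import all_boot all_order all_algebra.
From mathcomp Require Import classical_sets ring finmap.
(* The notations of monalg are incompatible with those of classical_sets. *)
From mathcomp Require Import -(notations) monalg.

Set Implicit Arguments.
Unset Strict Implicit.
Unset Printing Implicit Defensive.

Import Order.TTheory GRing.Theory Num.Theory.

Local Open Scope ring_scope.
Local Open Scope classical_set_scope.

Record lieAlgebra (K : fieldType) := LieAlgebra {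
  lie_sort :> lmodType K;
  lie_br : lie_sort -> lie_sort -> lie_sort;
  lie_linl : forall y, linear (fun x => lie_br x y);
  lie_linr : forall x, linear (fun y => lie_br x y);
  lie_alt : forall x, lie_br x x = 0;
  lie_jacobi : forall x y z, lie_br x (lie_br y z)
    + lie_br y (lie_br z x) + lie_br z (lie_br x y) = 0
}.

Record lieModule (K : fieldType) (L : lieAlgebra K) := LieModule {
  lmod_sort :> lmodType K;
  lmod_act : L -> lmod_sort -> lmod_sort;
  lmod_linl : forall v, linear (fun x => lmod_act x v);
  lmod_linr : forall x, linear (fun v => lmod_act x v);
  lmod_br : forall x y v, lmod_act (lie_br x y) v =
    lmod_act x (lmod_act y v) - lmod_act y (lmod_act x v)
}.

Record lieAut (K : fieldType) (L : lieAlgebra K) := LieAut {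
  laut_fun :> L -> L;
  laut_lin : linear laut_fun;
  laut_bij : bijective laut_fun;
  laut_br : {morph laut_fun : x y / lie_br x y}
}.

Definition lieModule_iso (K : fieldType) (L : lieAlgebra K)
    (M N : lieModule L) : Prop :=
  exists h : M -> N, [/\ linear h, bijective h &
    forall x v, h (lmod_act x v) = lmod_act x (h v)].

Record superSpace (K : fieldType) := SuperSpace {
  ss_sort :> lmodType K;
  ss_part : 'Z_2 -> ss_sort -> Prop;
  ss_part0 : forall i, ss_part i 0;
  ss_part_lin : forall i (c : K) u v,
    ss_part i u -> ss_part i v -> ss_part i (c *: u + v);
  ss_decomp : forall v,
    exists v0 v1, [/\ ss_part 0 v0, ss_part 1 v1 & v = v0 + v1];
  ss_direct : forall v, ss_part 0 v -> ss_part 1 v -> v = 0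
}.

Record lieSuperalgebra (K : fieldType) := LieSuperalgebra {
  slie_sort :> superSpace K;
  slie_br : slie_sort -> slie_sort -> slie_sort;
  slie_linl : forall y, linear (fun x => slie_br x y);
  slie_linr : forall x, linear (fun y => slie_br x y);
  slie_grad : forall i j x y,
    ss_part i x -> ss_part j y -> ss_part (i + j) (slie_br x y);
  slie_anti : forall (i j : 'Z_2) x y, ss_part i x -> ss_part j y ->
    slie_br x y = - ((-1) ^+ (i * j)%N *: slie_br y x);
  slie_jacobi : forall (i j k : 'Z_2) x y z,
    ss_part i x -> ss_part j y -> ss_part k z ->
    slie_br x (slie_br y z) = slie_br (slie_br x y) z
      + (-1) ^+ (i * j)%N *: slie_br y (slie_br x z)
}.

Record lieSupermodule (K : fieldType) (L : lieSuperalgebra K) :=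
  LieSupermodule {
  smod_sort :> superSpace K;
  smod_act : L -> smod_sort -> smod_sort;
  smod_linl : forall v, linear (fun x => smod_act x v);
  smod_linr : forall x, linear (fun v => smod_act x v);
  smod_grad : forall i j x v,
    ss_part i x -> ss_part j v -> ss_part (i + j) (smod_act x v);
  smod_br : forall (i j : 'Z_2) x y v, ss_part i x -> ss_part j y ->
    smod_act (slie_br x y) v = smod_act x (smod_act y v)
      - (-1) ^+ (i * j)%N *: smod_act y (smod_act x v)
}.

Record lieSuperAut (K : fieldType) (L : lieSuperalgebra K) := LieSuperAut {
  saut_fun :> L -> L;
  saut_lin : linear saut_fun;
  saut_bij : bijective saut_fun;
  saut_grad : forall i x, ss_part i x -> ss_part i (saut_fun x);
  saut_br : {morph saut_fun : x y / slie_br x y}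
}.

(* Isomorphisms of supermodules are even. *)
Definition lieSupermodule_iso (K : fieldType) (L : lieSuperalgebra K)
    (M N : lieSupermodule L) : Prop :=
  exists h : M -> N, [/\ linear h, bijective h,
    forall i v, ss_part i v -> ss_part i (h v) &
    forall x v, h (smod_act x v) = smod_act x (h v)].

Lemma lin_comp (K : fieldType) (U V W : lmodType K) (f : V -> W) (g : U -> V) :
  linear f -> linear g -> linear (fun x => f (g x)).
Proof. by move=> fL gL c u v; rewrite gL fL. Qed.

Section Twist.
Variables (K : fieldType) (L : lieAlgebra K) (phi : lieAut L).
Variable (M : lieModule L).

Definition twist_act (x : L) (v : M) : M := lmod_act (phi x) v.

Fact twist_linl v : linear (fun x => twist_act x v).
Proof. exact: lin_comp (lmod_linl v) (laut_lin phi). Qed.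

Fact twist_linr x : linear (fun v => twist_act x v).
Proof. exact: lmod_linr. Qed.

Fact twist_br x y v : twist_act (lie_br x y) v =
  twist_act x (twist_act y v) - twist_act y (twist_act x v).
Proof. by rewrite /twist_act laut_br lmod_br. Qed.

Definition lieTwist : lieModule L := LieModule twist_linl twist_linr twist_br.

End Twist.

Section SuperTwist.
Variables (K : fieldType) (L : lieSuperalgebra K) (phi : lieSuperAut L).
Variable (M : lieSupermodule L).

Definition stwist_act (x : L) (v : M) : M := smod_act (phi x) v.

Fact stwist_linl v : linear (fun x => stwist_act x v).
Proof. exact: lin_comp (smod_linl v) (saut_lin phi). Qed.

Fact stwist_linr x : linear (fun v => stwist_act x v).
Proof. exact: smod_linr. Qed.

Fact stwist_grad i j x v :
  ss_part i x -> ss_part j v -> ss_part (i + j) (stwist_act x v).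
Proof. by move=> xi vj; apply: smod_grad => //; apply: saut_grad. Qed.

Fact stwist_br (i j : 'Z_2) x y v : ss_part i x -> ss_part j y ->
  stwist_act (slie_br x y) v = stwist_act x (stwist_act y v)
    - (-1) ^+ (i * j)%N *: stwist_act y (stwist_act x v).
Proof.
by move=> xi yj; rewrite /stwist_act saut_br (@smod_br _ _ _ i j) //;
  apply: saut_grad.
Qed.

Definition lieSuperTwist : lieSupermodule L :=
  LieSupermodule stwist_linl stwist_linr stwist_grad stwist_br.

End SuperTwist.

Record subgroup_elt (V : zmodType) (G : zmodClosed V) :=
  SubgroupElt { gval : V; gvalP : gval \in G }.

HB.instance Definition _ (V : zmodType) (G : zmodClosed V) :=
  [isSub for @gval V G].
HB.instance Definition _ (V : zmodType) (G : zmodClosed V) :=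
  [Choice of subgroup_elt G by <:].
HB.instance Definition _ (V : zmodType) (G : zmodClosed V) :=
  [SubChoice_isSubZmodule of subgroup_elt G by <:].

Lemma gvalD (V : zmodType) (G : zmodClosed V) (m n : subgroup_elt G) :
  gval (m + n) = gval m + gval n.
Proof. by []. Qed.

(* Group homomorphisms from A to the multiplicative group of K; that they send
   0 to 1 follows (dual0). *)
Record dual (K : fieldType) (A : zmodType) := Dual {
  dual_fun :> A -> K;
  dual_neq0 : forall m, dual_fun m != 0;
  dualD : forall m n, dual_fun (m + n) = dual_fun m * dual_fun n
}.

Lemma dual0 (K : fieldType) (A : zmodType) (f : dual K A) : f 0 = 1.
Proof.
apply: (mulfI (dual_neq0 f 0)).
by rewrite -dualD addr0 mulr1.
Qed.

(** Maps of a subgroup to itself induced by [s] and by its inverse [t]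
    when [s] maps the subgroup onto itself. *)
Section SubgroupMap.
Variables (V : zmodType) (G : zmodClosed V) (s t : V -> V).
Hypothesis sG : s @` [set` G] = [set` G].
Hypothesis st : cancel s t.

Fact sub_fwd_mem (m : subgroup_elt G) : s (gval m) \in G.
Proof.
have : [set` G] (s (gval m)) by rewrite -sG; exists (gval m) => //; apply: gvalP.
by [].
Qed.

Fact sub_bwd_mem (m : subgroup_elt G) : t (gval m) \in G.
Proof.
have : [set` G] (gval m) by apply: gvalP.
by rewrite -sG => -[x xG <-]; rewrite st.
Qed.

Definition sub_fwd m := SubgroupElt (sub_fwd_mem m).
Definition sub_bwd m := SubgroupElt (sub_bwd_mem m).

Lemma sub_fwdK : cancel sub_fwd sub_bwd.
Proof. by move=> m; apply: val_inj; rewrite /= st. Qed.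

Lemma sub_bwdK : cancel sub_bwd sub_fwd.
Proof.
move=> m; apply: val_inj => /=.
have : [set` G] (gval m) by apply: gvalP.
by rewrite -sG => -[x xG <-]; rewrite st.
Qed.

End SubgroupMap.

HB.lock Definition fbasis (K : fieldType) (A : choiceType) (k : A) : malg A K :=
  mkmalgU k 1.
Arguments fbasis {K A} k.

HB.lock Definition flift (K : fieldType) (A : choiceType) (V : lmodType K)
    (F : A -> V) (x : malg A K) : V :=
  \sum_(k <- msupp x) mcoeff k x *: F k.

Section FreeModule.
Variables (K : fieldType) (A : choiceType).

Lemma mcoeff_basis (k l : A) : mcoeff l (@fbasis K A k) = (k == l)%:R.
Proof. by rewrite fbasis.unlock mcoeffU. Qed.

Lemma fliftEw (V : lmodType K) (F : A -> V) (x : malg A K) (d : {fset A}) :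
  fsubset (msupp x) d -> flift F x = \sum_(k <- d) mcoeff k x *: F k.
Proof.
move=> le; rewrite flift.unlock (big_fset_incl _ le) => //= k kd /mcoeff_outdom ->.
by rewrite scale0r.
Qed.

Lemma flift_basis (V : lmodType K) (F : A -> V) k : flift F (fbasis k) = F k.
Proof.
by rewrite fbasis.unlock (fliftEw _ msuppU_le) big_seq_fset1 mcoeffUU scale1r.
Qed.

Lemma flift_lin (V : lmodType K) (F : A -> V) : linear (flift F).
Proof.
move=> c x y /=.
pose d := (msupp x `|` msupp y `|` msupp (c *: x + y))%fset.
have dx : fsubset (msupp x) d by rewrite /d -fsetUA fsubsetUl.
have dy : fsubset (msupp y) d
  by apply: fsubset_trans (fsubsetUl _ _); apply: fsubsetUr.
have dxy : fsubset (msupp (c *: x + y)) d by apply: fsubsetUr.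
rewrite (fliftEw _ dx) (fliftEw _ dy) (fliftEw _ dxy).
rewrite scaler_sumr -big_split /=; apply: eq_bigr => k _.
by rewrite mcoeffD mcoeffZ scalerDl scalerA.
Qed.

Lemma fbasisE (x : malg A K) : x = flift (@fbasis K A) x.
Proof.
apply/malgP => k; rewrite flift.unlock raddf_sum /=.
rewrite (eq_bigr (fun l => mcoeff l x * (l == k)%:R)); last first.
  by move=> l _; rewrite mcoeffZ mcoeff_basis.
case: (boolP (k \in msupp x)) => [kx|kx].
  rewrite (big_fsetD1 k) //= eqxx mulr1 big1_fset ?addr0 // => l.
  by rewrite in_fsetD1 => /andP[/negPf-> _] _; rewrite mulr0.
rewrite (mcoeff_outdom kx) big1_fset // => l lx _.
by case: eqP => [e|_]; [move: kx; rewrite -e lx | rewrite mulr0].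
Qed.

Lemma lin_sum (U V : lmodType K) (h : U -> V) (hL : linear h) (s : seq A)
    (c : A -> K) (F : A -> U) :
  h (\sum_(k <- s) c k *: F k) = \sum_(k <- s) c k *: h (F k).
Proof.
have h0 : h 0 = 0.
  have := hL 1 0 0; rewrite !scale1r !addr0 => e.
  by apply: (@addIr _ (h 0)); rewrite add0r -e.
elim: s => [|k s IH]; first by rewrite !big_nil.
by rewrite !big_cons hL IH.
Qed.

Lemma lin_ext_supp (V : lmodType K) (h1 h2 : malg A K -> V) (x : malg A K) :
  linear h1 -> linear h2 ->
  (forall k, mcoeff k x != 0 -> h1 (fbasis k) = h2 (fbasis k)) -> h1 x = h2 x.
Proof.
move=> L1 L2 e; rewrite [x]fbasisE flift.unlock !lin_sum // big_seq [RHS]big_seq.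
by apply: eq_bigr => k kx; rewrite e // mcoeff_neq0.
Qed.

Lemma lin_ext (V : lmodType K) (h1 h2 : malg A K -> V) :
  linear h1 -> linear h2 ->
  (forall k, h1 (fbasis k) = h2 (fbasis k)) -> forall x, h1 x = h2 x.
Proof. by move=> L1 L2 e x; apply: lin_ext_supp. Qed.

End FreeModule.

Section Lin.
Variables (K : fieldType) (U V : lmodType K).
Implicit Types f g : U -> V.

Lemma lin_id : linear (fun x : U => x). Proof. by []. Qed.

Lemma lin_add f g : linear f -> linear g -> linear (fun x => f x + g x).
Proof. by move=> fL gL c u v; rewrite fL gL scalerDr addrACA. Qed.

Lemma lin_opp f : linear f -> linear (fun x => - f x).
Proof. by move=> fL c u v; rewrite fL opprD scalerN. Qed.

Lemma lin_scale b f : linear f -> linear (fun x => b *: f x).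
Proof. by move=> fL c u v; rewrite fL scalerDr !scalerA [b * c]mulrC. Qed.

Lemma scaler_congr (c d : K) (v : V) : c = d -> c *: v = d *: v.
Proof. by move->. Qed.

Lemma lin_zero : linear (fun _ : U => 0 : V).
Proof. by move=> c u v; rewrite scaler0 addr0. Qed.

Lemma lin0 f : linear f -> f 0 = 0.
Proof.
move=> fL; have := fL 1 0 0; rewrite !scale1r !addr0 => e.
by apply: (@addIr _ (f 0)); rewrite add0r -e.
Qed.

Lemma linZ f : linear f -> forall c u, f (c *: u) = c *: f u.
Proof. by move=> fL c u; have := fL c u 0; rewrite lin0 // !addr0. Qed.

Lemma flift_ind (A : choiceType) (h : malg A K -> V) (Q : V -> Prop) x :
  linear h -> Q 0 -> (forall c u v, Q u -> Q v -> Q (c *: u + v)) ->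
  (forall k, mcoeff k x != 0 -> Q (h (fbasis k))) -> Q (h x).
Proof.
move=> hL Q0 QL Qb; rewrite [x]fbasisE flift.unlock lin_sum // big_seq.
elim/big_rec: _ => [//|k y kx Qy]; apply: QL => //; apply: Qb.
by rewrite mcoeff_neq0.
Qed.

Lemma flift_fun_lin (A : choiceType) (F : A -> U -> V) (x : malg A K) :
  (forall k, linear (F k)) -> linear (fun v => flift (fun k => F k v) x).
Proof.
move=> FL c u v; rewrite flift.unlock scaler_sumr -big_split /=.
by apply: eq_bigr => k _; rewrite FL scalerDr !scalerA [_ * c]mulrC.
Qed.

End Lin.

Section Witt.
Variables (K : numFieldType) (Gamma : zmodClosed K).
Local Notation G := (subgroup_elt Gamma).
Local Notation L := (@fbasis K G).

Definition W_br (x y : malg G K) : malg G K :=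
  flift (fun m => flift (fun n => (gval m - gval n) *: L (m + n)) y) x.

Lemma W_brE m n : W_br (L m) (L n) = (gval m - gval n) *: L (m + n).
Proof. by rewrite /W_br !flift_basis. Qed.

Fact W_linl y : linear (fun x => W_br x y).
Proof. exact: flift_lin. Qed.

Fact W_linr x : linear (fun y => W_br x y).
Proof. by apply: flift_fun_lin => m; apply: flift_lin. Qed.

Let linl (U : lmodType K) (f : U -> malg G K) y :
  linear f -> linear (fun x => W_br (f x) y).
Proof. exact: (lin_comp (W_linl y)). Qed.

Let linr (U : lmodType K) (f : U -> malg G K) x :
  linear f -> linear (fun y => W_br x (f y)).
Proof. exact: (lin_comp (W_linr x)). Qed.

Lemma W_brZr x c y : W_br x (c *: y) = c *: W_br x y.
Proof. exact: linZ (W_linr x) c y. Qed.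

Lemma W_brZl x c y : W_br (c *: x) y = c *: W_br x y.
Proof. exact: linZ (W_linl y) c x. Qed.

Local Ltac lin := repeat first
  [ exact: lin_id | exact: lin_zero | apply: lin_add | apply: lin_opp
  | apply: lin_scale | apply: linl | apply: linr ].

Lemma W_anti x y : W_br x y = - W_br y x.
Proof.
apply: (@lin_ext _ _ _ (fun x => W_br x y) (fun x => - W_br y x)); try by lin.
move=> m; apply: (@lin_ext _ _ _ (W_br (L m)) (fun y => - W_br y (L m)));
  try by lin.
by move=> n; rewrite !W_brE -scaleNr opprB [n + m]addrC.
Qed.

Fact W_alt x : W_br x x = 0.
Proof.
have /eqP := W_anti x x; rewrite -addr_eq0 -mulr2n -scaler_nat.
rewrite scaler_eq0 => /orP[/eqP e|/eqP//].
by have := pnatr_eq0 K 2; rewrite e eqxx.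
Qed.

Fact W_jacobi x y z :
  W_br x (W_br y z) + W_br y (W_br z x) + W_br z (W_br x y) = 0.
Proof.
pose J x y z := W_br x (W_br y z) + W_br y (W_br z x) + W_br z (W_br x y).
apply: (@lin_ext _ _ _ (fun x => J x y z) (fun=> 0)); try by rewrite /J; lin.
move=> m; apply: (@lin_ext _ _ _ (fun y => J (L m) y z) (fun=> 0));
  try by rewrite /J; lin.
move=> n; apply: (@lin_ext _ _ _ (fun z => J (L m) (L n) z) (fun=> 0));
  try by rewrite /J; lin.
move=> p; rewrite /J 3!W_brE 3!W_brZr 3!W_brE 3!scalerA.
have -> : n + (p + m) = m + (n + p) by rewrite addrA addrC.
have -> : p + (m + n) = m + (n + p) by rewrite addrC addrA.
rewrite -!scalerDl !gvalD; apply/eqP; rewrite scaler_eq0; apply/orP; left.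
by apply/eqP; ring.
Qed.

Definition Witt : lieAlgebra K := LieAlgebra W_linl W_linr W_alt W_jacobi.

Section Omega.
Variables (f : dual K G) (alpha : K).

(* 'X stands for L_0; P(L_0 + m) is the composition of P with 'X + m. *)
Definition Omega_op (m : G) (P : {poly K}) : {poly K} :=
  f m *: (('X + (gval m * alpha)%:P) * (P \Po ('X + (gval m)%:P))).

Definition Omega_act (x : malg G K) (P : {poly K}) : {poly K} :=
  flift (fun m => Omega_op m P) x.

Lemma Omega_actE m P : Omega_act (L m) P = Omega_op m P.
Proof. exact: flift_basis. Qed.

Lemma Omega_op_lin m : linear (Omega_op m).
Proof.
move=> c P Q; rewrite /Omega_op comp_polyD comp_polyZ mulrDr scalerDr.
by rewrite -scalerAr !scalerA [_ * c]mulrC.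
Qed.

Fact Omega_linl P : linear (fun x => Omega_act x P).
Proof. exact: flift_lin. Qed.

Fact Omega_linr x : linear (fun P => Omega_act x P).
Proof. by apply: flift_fun_lin; apply: Omega_op_lin. Qed.

Fact Omega_br x y P : Omega_act (W_br x y) P =
  Omega_act x (Omega_act y P) - Omega_act y (Omega_act x P).
Proof.
have ll (U : lmodType K) (h : U -> malg G K) Q : linear h ->
    linear (fun x => Omega_act (h x) Q) by apply: (lin_comp (Omega_linl Q)).
have lr (U : lmodType K) (h : U -> {poly K}) u : linear h ->
    linear (fun x => Omega_act u (h x)) by apply: (lin_comp (Omega_linr u)).
have lin2 z : linear (fun x => Omega_act x (Omega_act z P) - Omega_act z (Omega_act x P)).
  by apply: lin_add; [apply: ll | apply: lin_opp; apply: lr; apply: Omega_linl].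
apply: (@lin_ext _ _ _ (fun x => Omega_act (W_br x y) P) (fun x =>
  Omega_act x (Omega_act y P) - Omega_act y (Omega_act x P))) => //.
  by apply: ll; apply: W_linl.
move=> m; apply: (@lin_ext _ _ _ (fun y => Omega_act (W_br (L m) y) P) (fun y =>
  Omega_act (L m) (Omega_act y P) - Omega_act y (Omega_act (L m) P))).
- by apply: ll; apply: W_linr.
- by apply: lin_add; [apply: lr; apply: Omega_linl | apply: lin_opp; apply: ll].
move=> n; rewrite W_brE (linZ (@Omega_linl P)) !Omega_actE /Omega_op.
rewrite !comp_polyZ !comp_polyM !comp_polyD !comp_polyX !comp_polyC.
rewrite -!comp_polyA !comp_polyD !comp_polyX !comp_polyC dualD gvalD.
rewrite -!addrA -!polyCD [gval n + gval m]addrC.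
move: (P \Po _) => Q; rewrite -!mul_polyC !polyCD !polyCM ?polyCB ?polyCN.
ring.
Qed.

Definition Omega : lieModule Witt :=
  @LieModule K Witt {poly K} Omega_act Omega_linl Omega_linr Omega_br.

End Omega.

Section Aut.
Variables (a : K) (a0 : a != 0).
Hypothesis aG : [set a * x | x in [set` Gamma]] = [set` Gamma].

Fact mulVK : cancel (fun x => a * x) (fun x => x / a).
Proof. by move=> x; rewrite mulrC mulKf. Qed.

Definition W_div : G -> G := sub_bwd aG mulVK.
Let W_mul : G -> G := sub_fwd aG.

Lemma W_divE m : gval (W_div m) = gval m / a. Proof. by []. Qed.

Lemma W_divD m n : W_div (m + n) = W_div m + W_div n.
Proof. by apply: val_inj; rewrite /= mulrDl. Qed.

Section Char.
Variables (f g : dual K G).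

Definition W_dual_fun (m : G) : K := f m * g (W_div m).

Fact W_dual_neq0 m : W_dual_fun m != 0.
Proof. by rewrite mulf_neq0 ?dual_neq0. Qed.

Fact W_dualD m n : W_dual_fun (m + n) = W_dual_fun m * W_dual_fun n.
Proof. by rewrite /W_dual_fun W_divD !dualD mulrACA. Qed.

(* The character g'(m) = f(m) g(m / a). *)
Definition W_dual : dual K G := Dual W_dual_neq0 W_dualD.

End Char.

Variable (f : dual K G).

Definition W_phi (x : malg G K) : malg G K :=
  flift (fun m => (a * f m) *: L (W_div m)) x.

Lemma W_phiE m : W_phi (L m) = (a * f m) *: L (W_div m).
Proof. exact: flift_basis. Qed.

Fact W_phi_lin : linear W_phi. Proof. exact: flift_lin. Qed.

Fact W_phi_bij : bijective W_phi.
Proof.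
pose psi := flift (fun m => (a * f (W_mul m))^-1 *: L (W_mul m)).
have psi_lin : linear psi by apply: flift_lin.
have nz m : a * f m != 0 by rewrite mulf_neq0 ?dual_neq0.
exists psi.
  move=> x; apply: (@lin_ext _ _ _ (fun x => psi (W_phi x)) (fun x => x)).
  - exact: lin_comp psi_lin W_phi_lin.
  - exact: lin_id.
  move=> m; rewrite W_phiE linZ // /psi flift_basis scalerA.
  by rewrite /W_mul /W_div sub_bwdK mulfV // scale1r.
move=> x; apply: (@lin_ext _ _ _ (fun x => W_phi (psi x)) (fun x => x)).
- exact: lin_comp W_phi_lin psi_lin.
- exact: lin_id.
move=> m; rewrite /psi flift_basis (linZ W_phi_lin) W_phiE scalerA.
by rewrite /W_mul /W_div sub_fwdK mulVf // scale1r.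
Qed.

Fact W_phi_br : {morph W_phi : x y / W_br x y}.
Proof.
move=> x y; apply: (@lin_ext _ _ _ (fun x => W_phi (W_br x y))
  (fun x => W_br (W_phi x) (W_phi y))).
- exact: lin_comp W_phi_lin (W_linl y).
- by apply: linl; apply: W_phi_lin.
move=> m; apply: (@lin_ext _ _ _ (fun y => W_phi (W_br (L m) y))
  (fun y => W_br (W_phi (L m)) (W_phi y))).
- exact: lin_comp W_phi_lin (W_linr _).
- by apply: linr; apply: W_phi_lin.
move=> n; rewrite W_brE (linZ W_phi_lin) !W_phiE.
rewrite W_brZl W_brZr W_brE W_divD !W_divE !scalerA.
rewrite dualD.
apply: scaler_congr.
move: (dual_fun f m) (dual_fun f n) (gval m) (gval n) => fm fn x' y'.
by field.
Qed.

Definition W_aut : lieAut Witt :=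
  @LieAut K Witt W_phi W_phi_lin W_phi_bij W_phi_br.

End Aut.

End Witt.

Lemma Z2P (i : 'Z_2) : i = 0 \/ i = 1.
Proof. by case: i => [[|[|//]] ?]; [left | right]; apply: val_inj. Qed.

Section SuperWitt.
Variables (K : numFieldType) (Gamma : zmodClosed (K * 'Z_2)%type).
Local Notation G := (subgroup_elt Gamma).

(* The basis vector indexed by (m, 0) is L_m, the one indexed by (r, 1)
   is G_r. *)
Local Notation E := (@fbasis K G).

(* [e_u, e_v] = sW_coef u v e_(u + v); the third value comes from
   [G_r, L_m] = - [L_m, G_r]. *)
Definition sW_coef (u v : K * 'Z_2) : K :=
  if u.2 == 0 then
    if v.2 == 0 then u.1 - v.1 else u.1 / 2 - v.1
  else
    if v.2 == 0 then - (v.1 / 2 - u.1) else 2.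

Definition sW_part (i : 'Z_2) (x : malg G K) : Prop :=
  forall u : G, (gval u).2 != i -> mcoeff u x = 0.

Definition sW_br (x y : malg G K) : malg G K :=
  flift (fun u : G => flift (fun v : G => sW_coef (gval u) (gval v) *: E (u + v)) y) x.

Lemma sW_brE u v : sW_br (E u) (E v) = sW_coef (gval u) (gval v) *: E (u + v).
Proof. by rewrite /sW_br !flift_basis. Qed.

Lemma sW_partP i x (u : G) : sW_part i x -> mcoeff u x != 0 -> (gval u).2 = i.
Proof. by move=> xi; apply: contraNeq => /xi ->. Qed.

Lemma sW_part_basis (u : G) : sW_part (gval u).2 (E u).
Proof.
move=> v; rewrite mcoeff_basis; case: (u =P v) => [->|//].
by rewrite eqxx.
Qed.

Fact sW_part0 i : sW_part i 0.
Proof. by move=> u _; rewrite mcoeff0. Qed.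

Fact sW_part_lin i (c : K) x y :
  sW_part i x -> sW_part i y -> sW_part i (c *: x + y).
Proof.
by move=> xi yi u ui; rewrite mcoeffD mcoeffZ xi // yi // mulr0 addr0.
Qed.

Lemma sW_partZ i (c : K) x : sW_part i x -> sW_part i (c *: x).
Proof. by move=> xi u ui; rewrite mcoeffZ xi // mulr0. Qed.

Fact sW_decomp x :
  exists x0 x1, [/\ sW_part 0 x0, sW_part 1 x1 & x = x0 + x1].
Proof.
pose pr (i : 'Z_2) := flift (fun u => ((gval u).2 == i)%:R *: E u).
have prP i y : sW_part i (pr i y).
  apply: (@flift_ind _ _ _ (pr i)).
  - exact: flift_lin.
  - exact: sW_part0.
  - by move=> c ? ?; apply: sW_part_lin.
  move=> u _; rewrite /pr flift_basis; case: eqP => [<-|_].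
    exact/sW_partZ/sW_part_basis.
  by rewrite scale0r; apply: sW_part0.
exists (pr 0 x), (pr 1 x); split=> //.
apply: (@lin_ext _ _ _ (fun x => x) (fun x => pr 0 x + pr 1 x)).
- exact: lin_id.
- by apply: lin_add; apply: flift_lin.
move=> u.
have prE i : pr i (E u) = ((gval u).2 == i)%:R *: E u by apply: flift_basis.
rewrite (prE 0) (prE 1) -scalerDl.
have Z2_sum (i : 'Z_2) : (i == 0)%:R + (i == 1)%:R = 1 :> K.
  by case: (Z2P i) => ->; rewrite ?addr0 ?add0r.
by rewrite Z2_sum scale1r.
Qed.

Fact sW_direct x : sW_part 0 x -> sW_part 1 x -> x = 0.
Proof.
move=> x0 x1; apply/malgP => u; rewrite mcoeff0.
by case: (Z2P (gval u).2) => e; [apply: x1 | apply: x0]; rewrite e.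
Qed.

Definition sW_space : superSpace K :=
  SuperSpace sW_part0 sW_part_lin sW_decomp sW_direct.

Fact sW_linl y : linear (fun x => sW_br x y).
Proof. exact: flift_lin. Qed.

Fact sW_linr x : linear (fun y => sW_br x y).
Proof. by apply: flift_fun_lin => m; apply: flift_lin. Qed.

Lemma sW_brZr x c y : sW_br x (c *: y) = c *: sW_br x y.
Proof. exact: linZ (sW_linr x) c y. Qed.

Lemma sW_brZl x c y : sW_br (c *: x) y = c *: sW_br x y.
Proof. exact: linZ (sW_linl y) c x. Qed.

Let linl (U : lmodType K) (f : U -> malg G K) y :
  linear f -> linear (fun x => sW_br (f x) y).
Proof. exact: (lin_comp (sW_linl y)). Qed.

Let linr (U : lmodType K) (f : U -> malg G K) x :
  linear f -> linear (fun y => sW_br x (f y)).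
Proof. exact: (lin_comp (sW_linr x)). Qed.

Local Ltac lin := repeat first
  [ exact: lin_id | exact: lin_zero | apply: lin_add | apply: lin_opp
  | apply: lin_scale | apply: linl | apply: linr ].

Fact sW_grad i j x y :
  sW_part i x -> sW_part j y -> sW_part (i + j) (sW_br x y).
Proof.
move=> xi yj; apply: (@flift_ind _ _ _ (fun x => sW_br x y)).
- exact: sW_linl.
- exact: sW_part0.
- by move=> c ? ?; apply: sW_part_lin.
move=> u ux; apply: (@flift_ind _ _ _ (sW_br (E u))).
- exact: sW_linr.
- exact: sW_part0.
- by move=> c ? ?; apply: sW_part_lin.
move=> v vy; rewrite sW_brE; apply: sW_partZ.
rewrite -(sW_partP xi ux) -(sW_partP yj vy).
exact: (@sW_part_basis (u + v)).
Qed.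

Lemma sW_coef_anti (u v : K * 'Z_2) :
  sW_coef u v = - ((-1) ^+ (u.2 * v.2)%N * sW_coef v u).
Proof.
case: u v => m i [n j]; rewrite /sW_coef /=.
by case: (Z2P i) => ->; case: (Z2P j) => -> /=; rewrite ?expr0 ?expr1; ring.
Qed.

Fact sW_anti (i j : 'Z_2) x y : sW_part i x -> sW_part j y ->
  sW_br x y = - ((-1) ^+ (i * j)%N *: sW_br y x).
Proof.
move=> xi yj.
apply: (@lin_ext_supp _ _ _ (fun x => sW_br x y)
  (fun x => - ((-1) ^+ (i * j)%N *: sW_br y x))); try by lin.
move=> u ux; apply: (@lin_ext_supp _ _ _ (sW_br (E u))
  (fun y => - ((-1) ^+ (i * j)%N *: sW_br y (E u)))); try by lin.
move=> v vy; rewrite !sW_brE [v + u]addrC scalerA -scaleNr.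
apply: scaler_congr; rewrite sW_coef_anti.
by rewrite (sW_partP xi ux) (sW_partP yj vy).
Qed.

Lemma sW_coef_jacobi (u v w : K * 'Z_2) :
  sW_coef v w * sW_coef u (v + w) =
  sW_coef u v * sW_coef (u + v) w
  + (-1) ^+ (u.2 * v.2)%N * (sW_coef u w * sW_coef v (u + w)).
Proof.
case: u v w => m i [n j] [p k]; rewrite /sW_coef /=.
by case: (Z2P i) => ->; case: (Z2P j) => ->; case: (Z2P k) => -> /=;
  rewrite ?expr0 ?expr1; field.
Qed.

Fact sW_jacobi (i j k : 'Z_2) x y z :
  sW_part i x -> sW_part j y -> sW_part k z ->
  sW_br x (sW_br y z) = sW_br (sW_br x y) z
    + (-1) ^+ (i * j)%N *: sW_br y (sW_br x z).
Proof.
move=> xi yj _.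
apply: (@lin_ext_supp _ _ _ (fun x => sW_br x (sW_br y z))
  (fun x => sW_br (sW_br x y) z
    + (-1) ^+ (i * j)%N *: sW_br y (sW_br x z))); try by lin.
move=> u ux; apply: (@lin_ext_supp _ _ _ (fun y => sW_br (E u) (sW_br y z))
  (fun y => sW_br (sW_br (E u) y) z
    + (-1) ^+ (i * j)%N *: sW_br y (sW_br (E u) z))); try by lin.
move=> v vy; apply: (@lin_ext _ _ _ (fun z => sW_br (E u) (sW_br (E v) z))
  (fun z => sW_br (sW_br (E u) (E v)) z
    + (-1) ^+ (i * j)%N *: sW_br (E v) (sW_br (E u) z))); try by lin.
move=> w; rewrite 3!sW_brE 2!sW_brZr sW_brZl 3!sW_brE 4!scalerA.
have -> : v + (u + w) = u + (v + w) by rewrite addrCA.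
have -> : u + v + w = u + (v + w) by rewrite addrA.
rewrite -scalerDl; apply: scaler_congr.
by rewrite -(sW_partP xi ux) -(sW_partP yj vy) sW_coef_jacobi !mulrA.
Qed.

Definition sWitt : lieSuperalgebra K :=
  @LieSuperalgebra K sW_space sW_br sW_linl sW_linr sW_grad sW_anti sW_jacobi.

(* The pair (P, Q) stands for P(L_0) + xi Q(L_0). *)
Definition sOmega_part (i : 'Z_2) (v : {poly K} * {poly K}) : Prop :=
  if i == 0 then v.2 = 0 else v.1 = 0.

Fact sOmega_part0 i : sOmega_part i 0.
Proof. by rewrite /sOmega_part; case: eqP. Qed.

Fact sOmega_part_lin i (c : K) u v :
  sOmega_part i u -> sOmega_part i v -> sOmega_part i (c *: u + v).
Proof.
by rewrite /sOmega_part; case: eqP => _ /= -> ->; rewrite scaler0 addr0.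
Qed.

Fact sOmega_decomp v :
  exists v0 v1, [/\ sOmega_part 0 v0, sOmega_part 1 v1 & v = v0 + v1].
Proof.
exists (v.1, 0), (0, v.2); split=> //.
by case: v => P Q; congr pair; rewrite /= ?addr0 ?add0r.
Qed.

Fact sOmega_direct v : sOmega_part 0 v -> sOmega_part 1 v -> v = 0.
Proof. by rewrite /sOmega_part /=; case: v => P Q /= -> ->. Qed.

Definition sOmega_space : superSpace K :=
  SuperSpace sOmega_part0 sOmega_part_lin sOmega_decomp sOmega_direct.

Section SuperOmega.
Variables (f : dual K G) (alpha : K).

Definition sOmega_op (u : G) (v : {poly K} * {poly K}) : {poly K} * {poly K} :=
  let m := (gval u).1 in
  let P := v.1 \Po ('X + m%:P) in
  let Q := v.2 \Po ('X + m%:P) in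
  f u *: (if (gval u).2 == 0
          then (('X + (m * alpha)%:P) * P, ('X + (m * (alpha + 1 / 2))%:P) * Q)
          else (('X + (2 * m * alpha)%:P) * Q, P)).

Definition sOmega_act (x : malg G K) (v : {poly K} * {poly K}) :
    {poly K} * {poly K} :=
  flift (fun u => sOmega_op u v) x.

Lemma sOmega_actE u v : sOmega_act (E u) v = sOmega_op u v.
Proof. exact: flift_basis. Qed.

Lemma pair_eq (A B : Type) (p q : A * B) : p.1 = q.1 -> p.2 = q.2 -> p = q.
Proof. by case: p q => ? ? [? ?] /= -> ->. Qed.

Lemma sOmega_op_lin u : linear (sOmega_op u).
Proof.
move=> c v w; rewrite /sOmega_op; case: eqP => _;
  apply: pair_eq => /=; rewrite !comp_polyD !comp_polyZ ?mulrDr scalerDr;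
  by rewrite -?scalerAr !scalerA [_ * c]mulrC.
Qed.

Fact sOmega_linl v : linear (fun x => sOmega_act x v).
Proof. exact: flift_lin. Qed.

Fact sOmega_linr x : linear (fun v => sOmega_act x v).
Proof. by apply: flift_fun_lin; apply: sOmega_op_lin. Qed.

Fact sOmega_grad i j x v :
  sW_part i x -> sOmega_part j v -> sOmega_part (i + j) (sOmega_act x v).
Proof.
move=> xi vj; apply: (@flift_ind _ _ _ (fun x => sOmega_act x v)).
- exact: sOmega_linl.
- exact: sOmega_part0.
- by move=> c ? ?; apply: sOmega_part_lin.
move=> u ux; rewrite sOmega_actE -(sW_partP xi ux) /sOmega_op.
move: vj; rewrite /sOmega_part.
by case: (Z2P (gval u).2) => ->; case: (Z2P j) => -> /= ->;
  rewrite comp_poly0 ?mulr0 scaler0.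
Qed.

Lemma sOmega_op_br (u v : G) w :
  sW_coef (gval u) (gval v) *: sOmega_op (u + v) w =
  sOmega_op u (sOmega_op v w)
  - (-1) ^+ ((gval u).2 * (gval v).2)%N *: sOmega_op v (sOmega_op u w).
Proof.
rewrite /sOmega_op /sW_coef dualD gvalD.
move: (dual_fun f u) (dual_fun f v) => fu fv.
case: u v w => [[m i] /= _] [[n j] /= _] [P Q] /=.
have sh (S : {poly K}) :
    ((S \Po ('X + m%:P)) \Po ('X + n%:P) = S \Po ('X + (m + n)%:P))
    * ((S \Po ('X + n%:P)) \Po ('X + m%:P) = S \Po ('X + (m + n)%:P)).
  rewrite -!comp_polyA !comp_polyD !comp_polyX !comp_polyC -!addrA -!polyCD.
  by rewrite [n + m]addrC.
have hq (x : K) : (x + x) * (alpha + 1 / 2) = (x + x) * alpha + x by field.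
have hq2 (x y : K) : (x + x + (y + y)) * (alpha + 1 / 2) =
  (x + x + (y + y)) * alpha + (x + y) by field.
have hd (x : K) : x = x / 2 + x / 2 by field.
move: (m / 2) (n / 2) (hd m) (hd n) => m' n' -> -> in sh *.
rewrite !hq2 !hq.
have e2 : (2 : K)%:P = 2 by rewrite polyC_natr.
case: (Z2P i) => ->; case: (Z2P j) => -> /=; rewrite ?expr0 ?expr1;
  apply: pair_eq => /=;
  rewrite ?comp_polyZ ?comp_polyM ?comp_polyD ?comp_polyX ?comp_polyC ?sh;
  rewrite -!mul_polyC ?(polyCD, polyCM, polyCN, e2, mul1r); ring.
Qed.

Fact sOmega_br (i j : 'Z_2) x y v : sW_part i x -> sW_part j y ->
  sOmega_act (sW_br x y) v = sOmega_act x (sOmega_act y v)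
    - (-1) ^+ (i * j)%N *: sOmega_act y (sOmega_act x v).
Proof.
move=> xi yj.
have ll (U : lmodType K) (h : U -> malg G K) w : linear h ->
    linear (fun x => sOmega_act (h x) w) by apply: (lin_comp (sOmega_linl w)).
have lr (U : lmodType K) (h : U -> {poly K} * {poly K}) u : linear h ->
    linear (fun x => sOmega_act u (h x)) by apply: (lin_comp (sOmega_linr u)).
apply: (@lin_ext_supp _ _ _ (fun x => sOmega_act (sW_br x y) v)
  (fun x => sOmega_act x (sOmega_act y v)
    - (-1) ^+ (i * j)%N *: sOmega_act y (sOmega_act x v))).
- by apply: ll; apply: sW_linl.
- apply: lin_add; first exact: sOmega_linl.
  by apply: lin_opp; apply: lin_scale; apply: lr; apply: sOmega_linl.
move=> u ux.
apply: (@lin_ext_supp _ _ _ (fun y => sOmega_act (sW_br (E u) y) v)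
  (fun y => sOmega_act (E u) (sOmega_act y v)
    - (-1) ^+ (i * j)%N *: sOmega_act y (sOmega_act (E u) v))).
- by apply: ll; apply: sW_linr.
- apply: lin_add; first by apply: lr; apply: sOmega_linl.
  by apply: lin_opp; apply: lin_scale; apply: sOmega_linl.
move=> w wy; rewrite sW_brE (linZ (@sOmega_linl v)) !sOmega_actE sOmega_op_br.
by rewrite (sW_partP xi ux) (sW_partP yj wy).
Qed.

Definition sOmega : lieSupermodule sWitt :=
  @LieSupermodule K sWitt sOmega_space sOmega_act
    sOmega_linl sOmega_linr sOmega_grad sOmega_br.

End SuperOmega.

Definition scale1 (b : K) (u : K * 'Z_2) : K * 'Z_2 := (b * u.1, u.2).

Section SuperAut.
Variables (a : K) (a0 : a != 0).
Hypothesis aG : scale1 (a ^+ 2) @` [set` Gamma] = [set` Gamma].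

Fact scale1K :
  cancel (scale1 (a ^+ 2)) (fun u => (u.1 / a ^+ 2, u.2)).
Proof.
by case=> x i; congr pair; rewrite /= mulrC mulKf // expf_neq0.
Qed.

Definition sW_div : G -> G := sub_bwd aG scale1K.
Let sW_mul : G -> G := sub_fwd aG.

Lemma sW_divE u : gval (sW_div u) = ((gval u).1 / a ^+ 2, (gval u).2).
Proof. by []. Qed.

Lemma sW_divD u v : sW_div (u + v) = sW_div u + sW_div v.
Proof. by apply: val_inj; rewrite /= mulrDl. Qed.

Section Char.
Variables (f g : dual K G).

Definition sW_dual_fun (u : G) : K := f u * g (sW_div u).

Fact sW_dual_neq0 u : sW_dual_fun u != 0.
Proof. by rewrite mulf_neq0 ?dual_neq0. Qed.

Fact sW_dualD u v : sW_dual_fun (u + v) = sW_dual_fun u * sW_dual_fun v.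
Proof. by rewrite /sW_dual_fun sW_divD !dualD mulrACA. Qed.

(* The character g'(u) = f(u) g(u / a^2). *)
Definition sW_dual : dual K G := Dual sW_dual_neq0 sW_dualD.

End Char.

Variable (f : dual K G).

Let wt (u : G) : K := if (gval u).2 == 0 then a ^+ 2 else a.

Definition sW_phi (x : malg G K) : malg G K :=
  flift (fun u : G =>
    ((if (gval u).2 == 0 then a ^+ 2 else a) * f u) *: E (sW_div u)) x.

Lemma sW_phiE u : sW_phi (E u) =
  ((if (gval u).2 == 0 then a ^+ 2 else a) * f u) *: E (sW_div u).
Proof. exact: flift_basis. Qed.

Fact sW_phi_lin : linear sW_phi. Proof. exact: flift_lin. Qed.

Fact sW_phi_bij : bijective sW_phi.
Proof.
pose psi := flift (fun u => (wt (sW_mul u) * f (sW_mul u))^-1 *: E (sW_mul u)).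
have psi_lin : linear psi by apply: flift_lin.
have psiE u : psi (E u) =
    (wt (sW_mul u) * f (sW_mul u))^-1 *: E (sW_mul u) by apply: flift_basis.
have nz u : wt u * f u != 0.
  by rewrite /wt mulf_neq0 ?dual_neq0 //; case: ifP; rewrite // expf_neq0.
exists psi.
  move=> x; apply: (@lin_ext _ _ _ (fun x => psi (sW_phi x)) (fun x => x)).
  - exact: lin_comp psi_lin sW_phi_lin.
  - exact: lin_id.
  move=> u; rewrite sW_phiE -/(wt u) (linZ psi_lin) psiE scalerA.
  by rewrite /sW_mul /sW_div sub_bwdK mulfV ?scale1r; last exact: nz.
move=> x; apply: (@lin_ext _ _ _ (fun x => sW_phi (psi x)) (fun x => x)).
- exact: lin_comp sW_phi_lin psi_lin.
- exact: lin_id.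
move=> u; rewrite psiE (linZ sW_phi_lin) sW_phiE scalerA.
by rewrite /sW_mul /sW_div sub_fwdK -/(wt _) mulVf ?scale1r; last exact: nz.
Qed.

Fact sW_phi_grad i x : sW_part i x -> sW_part i (sW_phi x).
Proof.
move=> xi; apply: (@flift_ind _ _ _ sW_phi).
- exact: sW_phi_lin.
- exact: sW_part0.
- by move=> c ? ?; apply: sW_part_lin.
move=> u ux; rewrite sW_phiE; apply: sW_partZ.
rewrite -(sW_partP xi ux).
exact: (@sW_part_basis (sW_div u)).
Qed.

Lemma sW_phi_coef (u v : K * 'Z_2) :
  sW_coef u v * (if (u + v).2 == 0 then a ^+ 2 else a) =
  (if u.2 == 0 then a ^+ 2 else a) * (if v.2 == 0 then a ^+ 2 else a)
  * sW_coef (u.1 / a ^+ 2, u.2) (v.1 / a ^+ 2, v.2).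
Proof.
case: u v => m i [n j]; rewrite /sW_coef /=.
by case: (Z2P i) => ->; case: (Z2P j) => -> /=; field.
Qed.

Fact sW_phi_br : {morph sW_phi : x y / sW_br x y}.
Proof.
move=> x y; apply: (@lin_ext _ _ _ (fun x => sW_phi (sW_br x y))
  (fun x => sW_br (sW_phi x) (sW_phi y))).
- exact: lin_comp sW_phi_lin (sW_linl y).
- by apply: linl; apply: sW_phi_lin.
move=> u; apply: (@lin_ext _ _ _ (fun y => sW_phi (sW_br (E u) y))
  (fun y => sW_br (sW_phi (E u)) (sW_phi y))).
- exact: lin_comp sW_phi_lin (sW_linr _).
- by apply: linr; apply: sW_phi_lin.
move=> v; rewrite sW_brE (linZ sW_phi_lin) !sW_phiE.
rewrite sW_brZl sW_brZr sW_brE sW_divD !sW_divE !scalerA.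
apply: scaler_congr; rewrite dualD.
have := sW_phi_coef (gval u) (gval v); rewrite -gvalD => e.
by rewrite mulrA e mulrAC; congr (_ * _); rewrite [RHS]mulrACA.
Qed.

Definition sW_aut : lieSuperAut sWitt :=
  @LieSuperAut K sWitt sW_phi sW_phi_lin sW_phi_bij sW_phi_grad sW_phi_br.

End SuperAut.

End SuperWitt.

(* Main.v *)
Require Import Defs.
From mathcomp Require Import all_boot all_order all_algebra.
From mathcomp Require Import classical_sets reals complex ring.
From mathcomp Require Import -(notations) monalg.
Import GRing.Theory Num.Theory.
Local Open Scope ring_scope.
Local Open Scope classical_set_scope.

(** Twisting multiplies [L_0] by the scalar [c] ([c = a] for the Witt algebra,
    [c = a^2] for the super Witt algebra) and divides the shifts by [c], so a
    twisted module is the original one in the rescaled variable [L_0 / c].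
    The isomorphism is therefore the substitution [P(L_0) |-> P(L_0 / c)].  It
    turns the shift by [m / c] into the shift by [m] ([rescale_shift]) and the
    factor [c (L_0 + m alpha / c)] into [L_0 + m alpha]
    ([rescale_linear_factor]), which leaves exactly the scalar
    [f(m) g(m / c) = g'(m)].

    In the super case an odd generator carries the weight [a] instead of
    [a^2].  This is absorbed by dividing the odd summand by [a]: going from
    even to odd, [a] cancels against the factor [1 / a]; going from odd to even,
    [a (L_0 / a^2 + 2 r alpha / a^2) = (1 / a) (L_0 + 2 r alpha)], and the
    factor [1 / a] is the one already carried by the odd argument. *)

Definition rescale {K : fieldType} (b : K) (P : {poly K}) : {poly K} :=
  P \Po (b *: 'X).

Lemma rescale_lin (K : fieldType) (b : K) : linear (rescale b).
Proof. by move=> c P Q; rewrite /rescale comp_polyD comp_polyZ. Qed.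

Lemma rescaleM (K : fieldType) (b : K) P Q :
  rescale b (P * Q) = rescale b P * rescale b Q.
Proof. exact: comp_polyM. Qed.

Lemma rescaleK (K : fieldType) (b c : K) :
  b * c = 1 -> cancel (rescale b) (rescale c).
Proof.
move=> bc P; rewrite /rescale -comp_polyA comp_polyZ comp_polyX scalerA bc.
by rewrite scale1r comp_polyXr.
Qed.

(** With [b] the inverse of the number by which the twist divides the shifts,
    this says that the substitution undoes that division. *)
Lemma rescale_shift (K : fieldType) (b m : K) (P : {poly K}) :
  rescale b (P \Po ('X + (b * m)%:P)) = rescale b P \Po ('X + m%:P).
Proof.
rewrite /rescale -!comp_polyA !comp_polyD comp_polyZ !comp_polyX !comp_polyC.
by rewrite scalerDr -[b *: m%:P]mul_polyC polyCM.
Qed.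

Lemma rescale_linear_factor (K : fieldType) (b m : K) :
  rescale b ('X + (b * m)%:P) = b *: ('X + m%:P).
Proof.
by rewrite /rescale comp_polyD comp_polyX comp_polyC scalerDr -[b *: m%:P]mul_polyC
  polyCM.
Qed.

Lemma Omega_twist_iso (K : numFieldType) (Gamma : zmodClosed K)
    (f g : dual K (subgroup_elt Gamma)) (alpha a : K) (a0 : a != 0)
    (aG : [set a * x | x in [set` Gamma]] = [set` Gamma]) :
  lieModule_iso (lieTwist (W_aut a0 aG f) (Omega g alpha))
    (Omega (W_dual a0 aG f g) alpha).
Proof.
have hL := rescale_lin K a^-1.
exists (rescale a^-1); split=> //.
  by exists (rescale a); apply: rescaleK; rewrite ?mulVf ?mulfV.
move=> x P /=.
apply: (@lin_ext _ _ _
  (fun x => rescale a^-1 (Omega_act g alpha (W_phi a0 aG f x) P))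
  (fun x => Omega_act (W_dual a0 aG f g) alpha x (rescale a^-1 P))).
- exact: lin_comp hL (lin_comp (Omega_linl g alpha P) (W_phi_lin a0 aG f)).
- exact: Omega_linl.
move=> m; rewrite W_phiE (linZ (Omega_linl g alpha P)) !Omega_actE.
rewrite /Omega_op W_divE !(linZ hL) rescaleM [gval m / a]mulrC -mulrA.
rewrite rescale_shift rescale_linear_factor -scalerAl !scalerA /=.
by apply: scaler_congr; rewrite /W_dual_fun; field.
Qed.

Lemma sOmega_twist_iso (K : numFieldType) (Gamma : zmodClosed (K * 'Z_2)%type)
    (f g : dual K (subgroup_elt Gamma)) (alpha a : K) (a0 : a != 0)
    (aG : scale1 (a ^+ 2) @` [set` Gamma] = [set` Gamma]) :
  lieSupermodule_iso (lieSuperTwist (sW_aut a0 aG f) (sOmega g alpha))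
    (sOmega (sW_dual a0 aG f g) alpha).
Proof.
set b := (a ^+ 2)^-1.
have a20 : a ^+ 2 != 0 by rewrite expf_neq0.
have bL := rescale_lin K b.
(* The factor [a^-1] on the odd summand is forced by the odd generators, which
   scale by [a] while [L_0] scales by [a ^+ 2]. *)
pose h (v : {poly K} * {poly K}) : {poly K} * {poly K} :=
  (rescale b v.1, a^-1 *: rescale b v.2).
have hL : linear h.
  by move=> c v w; apply: Defs.pair_eq; rewrite /= bL // scalerDr !scalerA [_ * c]mulrC.
exists h; split=> //.
- exists (fun v => (rescale (a ^+ 2) v.1, rescale (a ^+ 2) (a *: v.2))).
    move=> v; apply: Defs.pair_eq; rewrite /= ?scalerA ?mulfV ?scale1r //;
      by apply: rescaleK; rewrite mulVf.
  move=> v; apply: Defs.pair_eq; rewrite /= rescaleK ?mulfV //.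
  by rewrite scalerA mulVf ?scale1r.
- move=> i v /=; rewrite /sOmega_part.
  by case: eqP => _ /= ->; rewrite (lin0 bL) ?scaler0.
move=> x v /=.
apply: (@lin_ext _ _ _
  (fun x => h (sOmega_act g alpha (sW_phi a0 aG f x) v))
  (fun x => sOmega_act (sW_dual a0 aG f g) alpha x (h v))).
- exact: lin_comp hL (lin_comp (sOmega_linl g alpha v) (sW_phi_lin a0 aG f)).
- exact: sOmega_linl.
move=> u; rewrite sW_phiE (linZ (sOmega_linl g alpha v)) !sOmega_actE.
rewrite !(linZ hL) /sOmega_op sW_divE /= /sW_dual_fun.
(* The constants of the linear factors take the form [b * _], as the rescaling
   lemmas require. *)
have e (r c : K) : r / a ^+ 2 * c = b * (r * c) by rewrite mulrAC mulrC.
have e2 (r c : K) : 2 * (r / a ^+ 2) * c = b * (2 * r * c).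
  by rewrite mulrA mulrAC mulrC.
rewrite !e !e2 [(gval u).1 / _]mulrC -/b.
case: eqP => _; apply: Defs.pair_eq => /=;
  rewrite ?(linZ bL) ?rescaleM !rescale_shift ?rescale_linear_factor;
  rewrite ?comp_polyZ -?scalerAl -?scalerAr !scalerA;
  by apply: scaler_congr; rewrite /b; field.
Qed.

Theorem proposition4p2 (R : realType) :
  (forall (Gamma : zmodClosed R[i]), 1 \in Gamma ->
     forall (f g : dual R[i] (subgroup_elt Gamma)) (alpha a : R[i])
       (a0 : a != 0) (aG : [set a * x | x in [set` Gamma]] = [set` Gamma]),
     lieModule_iso
       (lieTwist (W_aut a0 aG f) (Omega g alpha))
       (Omega (W_dual a0 aG f g) alpha))
  /\
  (forall (Gamma : zmodClosed (R[i] * 'Z_2)%type)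
     (f g : dual R[i] (subgroup_elt Gamma)) (alpha a : R[i])
     (a0 : a != 0)
     (aG : scale1 (a ^+ 2) @` [set` Gamma] = [set` Gamma]),
     0 <= complex.Re a ->
     lieSupermodule_iso
       (lieSuperTwist (sW_aut a0 aG f) (sOmega g alpha))
       (sOmega (sW_dual a0 aG f g) alpha)).
Proof.
split=> [Gamma _ f g alpha a a0 aG|Gamma f g alpha a a0 aG _].
  exact: Omega_twist_iso.
exact: sOmega_twist_iso.
Qed.
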